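(* Let $M$ be a locally convex manifold and let $X\in\mathcal V(M)$ be a locally integrable smooth vector field. For $x\in M$ let $\gamma_x:I_x\to M$ be the unique maximal integral curve of $X$ through $x$ (with $0\in I_x$, $\gamma_x(0)=x$). Then $X$ is the velocity field of a unique local flow defined by $$\mathcal D_X:=\bigcup_{x\in M}I_x\times\{x\}\quad\text{and}\quad\Phi_t(x):=\gamma_x(t)\quad\text{for}\quad(t,x)\in\mathcal D_X.$$ That is, $\mathcal D_X$ is open in $\mathbb R\times M$, $\Phi:\mathcal D_X\to M$ is a (smooth) local flow with velocity field $X$, and it is the only local flow with domain $\mathcal D_X$ and velocity field $X$.
   Context: Locally convex manifold: a (Hausdorff) smooth manifold modeled on a locally convex space; $\mathcal V(M)$ is the space of smooth vector fields. A local flow on $M$ is a smooth map $\Phi:\mathcal D\to M$, $(t,x)\mapsto\Phi_t(x)$, where $\mathcal D\subseteq\mathbb R\times M$ is an open subset containing $\{0\}\times M$, such that for each $x\in M$ the set $\{t\in\mathbb R:(t,x)\in\mathcal D\}$ is an interval containing $0$, $\Phi_0=\mathrm{id}_M$, and $\Phi_t\Phi_s(x)=\Phi_{s+t}(x)$ for all $t,s,x$ for which both sides are defined. Its velocity field is $X^\Phi(x):=\frac{d}{dt}|_{t=0}\Phi_t(x)$. A smooth vector field is locally integrable if it is the velocity field of some local flow. An integral curve of $X$ on an open interval $I\ni0$ is a differentiable map $\gamma:I\to M$ with $\gamma'(t)=X(\gamma(t))$ for all $t\in I$; it is maximal if it has no proper extension to an integral curve on a larger open interval. For locally integrable $X$,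 through each $x\in M$ there is a unique maximal integral curve $\gamma_x:I_x\to M$ with $\gamma_x(0)=x$. *)

(* Defs.v *)
From HB Require Import structures.
From mathcomp Require Import all_boot all_order all_algebra.
From mathcomp Require Import all_classical all_reals all_analysis.

Set Implicit Arguments.
Unset Strict Implicit.
Unset Printing Implicit Defensive.

Import Order.TTheory GRing.Theory Num.Theory.
Import numFieldNormedType.Exports.

Local Open Scope classical_set_scope.
Local Open Scope ring_scope.

(** Calculus in locally convex spaces (Michal-Bastiani).  The library's
    [derive] and [derivable] are restricted to normed modules, hence the
    following relational version. *)

Definition has_deriv (R : realType) (E F : tvsType R) (f : E -> F) (x v : E)
    (l : F) : Prop :=
  (fun h : R => h^-1 *: (f (x + h *: v) - f x)) @ 0^' --> l.

(* [f] is C^0 on the open set U if it is continuous there; it is C^(n+1) if it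
   is continuous, all directional derivatives df(x, v) with x in U exist, and
   df : U x E -> F is C^n.  When F is Hausdorff the values of [df] on U x E are
   determined by [f]; values of [f] outside of U play no role. *)
Fixpoint Cn (R : realType) (n : nat) (E F : tvsType R) (U : set E)
    (f : E -> F) {struct n} : Prop :=
  (forall x, U x -> {for x, continuous f}) /\
  if n is m.+1 then
    exists2 df : E * E -> F,
      forall x v, U x -> has_deriv f x v (df (x, v)) &
      @Cn R m (E * E)%type F (U `*` setT) df
  else True.

Definition smooth (R : realType) (E F : tvsType R) (U : set E) (f : E -> F) :
  Prop := forall n, Cn n U f.

(* A homeomorphism between an open subset [cdom] of M and an open subset [ccod]
   of E; both maps are total functions, with arbitrary values elsewhere. *)
Record chart (R : realType) (M : topologicalType) (E : tvsType R) := Chart {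
  cdom : set M;
  ccod : set E;
  cmap :> M -> E;
  cinv : E -> M;
  cdom_open : open cdom;
  ccod_open : open ccod;
  cmap_cod : forall x, cdom x -> ccod (cmap x);
  cinv_dom : forall e, ccod e -> cdom (cinv e);
  cmapK : forall x, cdom x -> cinv (cmap x) = x;
  cinvK : forall e, ccod e -> cmap (cinv e) = e;
  cmap_continuous : forall x, cdom x -> {for x, continuous cmap};
  cinv_continuous : forall e, ccod e -> {for e, continuous cinv} }.

Record manifold (R : realType) (E : tvsType R) := Manifold {
  carrier :> topologicalType;
  atlas : set (chart carrier E);
  manifold_hausdorff : hausdorff_space carrier;
  atlas_cover : forall x : carrier, exists2 c, atlas c & cdom c x;
  atlas_compat : forall c d, atlas c -> atlas d ->
    smooth (ccod c `&` cinv c @^-1` cdom d) (d \o cinv c) }.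
Arguments atlas {R E} m _.

(* Smoothness on an open subset D of N of a map N -> M, where the smooth
   structures of N and M are given by the families of charts [A] and [B]. *)
Definition smooth_on (R : realType) (N M : topologicalType) (E F : tvsType R)
    (A : set (chart N E)) (B : set (chart M F)) (D : set N) (f : N -> M) :
    Prop :=
  (forall x, D x -> {for x, continuous f}) /\
  forall c d, A c -> B d ->
    smooth (ccod c `&` cinv c @^-1` (D `&` f @^-1` cdom d)) (d \o f \o cinv c).

Section line_times_manifold.
Context (R : realType) (M : topologicalType) (E : tvsType R) (c : chart M E).

Let lmap (p : R^o * M) : R^o * E := (p.1, c p.2).
Let linv (p : R^o * E) : R^o * M := (p.1, cinv c p.2).

Let open_setTX (T : topologicalType) (A : set T) :
  open A -> open ([set: R^o] `*` A).
Proof.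
rewrite !openE => oA [t x] [_ /= Ax]; exists (setT, A) => //=.
by split; [exact: filterT|exact: oA].
Qed.

Let lmap_continuous p :
  ([set: R^o] `*` cdom c) p -> {for p, continuous lmap}.
Proof.
move=> [_ cp]; apply: (@cvg_pair _ _ _ (nbhs p) (nbhs p.1) (nbhs (c p.2))
    _ _ _ fst (c \o snd)); first exact: cvg_fst.
by apply: continuous_comp; [exact: cvg_snd|exact: cmap_continuous].
Qed.

Let linv_continuous p :
  ([set: R^o] `*` ccod c) p -> {for p, continuous linv}.
Proof.
move=> [_ cp]; apply: (@cvg_pair _ _ _ (nbhs p) (nbhs p.1) (nbhs (cinv c p.2))
    _ _ _ fst (cinv c \o snd)); first exact: cvg_fst.
by apply: continuous_comp; [exact: cvg_snd|exact: cinv_continuous].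
Qed.

Let lmap_cod p : ([set: R^o] `*` cdom c) p -> ([set: R^o] `*` ccod c) (lmap p).
Proof. by move=> [_ cp]; split=> //; exact: cmap_cod. Qed.

Let linv_dom p : ([set: R^o] `*` ccod c) p -> ([set: R^o] `*` cdom c) (linv p).
Proof. by move=> [_ cp]; split=> //; exact: cinv_dom. Qed.

Let lmapK p : ([set: R^o] `*` cdom c) p -> linv (lmap p) = p.
Proof. by case: p => t x [_ cp]; rewrite /linv /lmap /= cmapK. Qed.

Let linvK p : ([set: R^o] `*` ccod c) p -> lmap (linv p) = p.
Proof. by case: p => t x [_ cp]; rewrite /linv /lmap /= cinvK. Qed.

Definition line_chart : chart (R^o * M)%type (R^o * E)%type :=
  Chart (open_setTX (cdom_open c)) (open_setTX (ccod_open c))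
    lmap_cod linv_dom lmapK linvK lmap_continuous linv_continuous.

End line_times_manifold.

Definition line_atlas (R : realType) (E : tvsType R) (M : manifold E) :
  set (chart (R^o * M)%type (R^o * E)%type) := @line_chart R M E @` atlas M.
Arguments line_atlas {R E} M _.

(* T_x M: a tangent vector is the family of its coordinates in all charts
   around x, related by the derivatives of the changes of charts.  The
   coordinate in a chart that is not around x is set to 0. *)
Record tangent (R : realType) (E : tvsType R) (M : manifold E) (x : M) :=
  Tangent {
  tcoord : chart M E -> E;
  tcoord_change : forall c d, atlas M c -> atlas M d -> cdom c x -> cdom d x ->
    has_deriv (d \o cinv c) (c x) (tcoord c) (tcoord d);
  tcoord_out : forall c, ~ (atlas M c /\ cdom c x) -> tcoord c = 0 }.

Record vector_field (R : realType) (E : tvsType R) (M : manifold E) :=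
  VectorField {
  field_at :> forall x : M, tangent x;
  field_smooth : forall c, atlas M c ->
    smooth (ccod c) (fun e => tcoord (field_at (cinv c e)) c) }.

(* The curve [g] passes through x at time t, is differentiable there and
   g'(t) = v. Continuity has to be required, as [c (g s)] is meaningless when
   [g s] is not in the domain of c. *)
Definition has_velocity (R : realType) (E : tvsType R) (M : manifold E)
    (g : R -> M) (t : R) (x : M) (v : tangent x) : Prop :=
  [/\ g t = x, {for t, continuous g} &
      forall c, atlas M c -> cdom c x ->
        @has_deriv R R^o E (c \o g) t 1 (tcoord v c)].

Definition integral_curve (R : realType) (E : tvsType R) (M : manifold E)
    (X : vector_field M) (I : set R) (g : R -> M) : Prop :=
  [/\ open I, is_interval I, I 0 &
      forall t, I t -> has_velocity g t (X (g t))].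

Definition maximal_integral_curve (R : realType) (E : tvsType R)
    (M : manifold E) (X : vector_field M) (I : set R) (g : R -> M) : Prop :=
  integral_curve X I g /\
  forall (J : set R) (k : R -> M), integral_curve X J k ->
    I `<=` J -> (forall t, I t -> k t = g t) -> J = I.

Record local_flow (R : realType) (E : tvsType R) (M : manifold E)
    (D : set (R^o * M)) (Phi : R^o * M -> M) : Prop := LocalFlow {
  flow_open : open D;
  flow_dom0 : forall x, D (0, x);
  flow_interval : forall x, is_interval [set t : R | D (t, x)];
  flow_smooth : smooth_on (line_atlas M) (atlas M) D Phi;
  flow0 : forall x, Phi (0, x) = x;
  flowD : forall t s x, D (s, x) -> D (t, Phi (s, x)) -> D (s + t, x) ->
    Phi (t, Phi (s, x)) = Phi (s + t, x) }.

Definition velocity_field (R : realType) (E : tvsType R) (M : manifold E)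
    (Phi : R^o * M -> M) (X : vector_field M) : Prop :=
  forall x, has_velocity (fun t => Phi (t, x)) 0 (X x).

Definition locally_integrable_field (R : realType) (E : tvsType R) (M : manifold E)
    (X : vector_field M) : Prop :=
  exists D Phi, local_flow D Phi /\ velocity_field Phi X.

(* Main.v *)
Require Import Defs.
From mathcomp Require Import all_boot all_order all_algebra.
From mathcomp Require Import all_classical all_reals all_analysis.
From mathcomp Require Import ring lra.
Import numFieldNormedType.Exports.
Import Order.TTheory GRing.Theory Num.Theory.
Local Open Scope classical_set_scope.
Local Open Scope ring_scope.

(** Why the theorem holds.  Let [Psi], with domain [D0], be some local flow with
    velocity field X.

    Integral curves are unique.  If [g] is an integral curve, then
    [s |-> Psi (- s, g s)] has zero velocity ([transported_velocity]), so it is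
    constant as long as it stays in a chart ([zero_deriv_constant]); therefore
    [g] follows the local flow ([flow_follows]).  Two integral curves that meet
    thus agree near the meeting time, and as M is Hausdorff they agree on the
    whole common interval ([integral_curve_unique]).  By gluing, every integral
    curve from x is a restriction of the maximal one ([maximal_curve_unique]).
    This gives uniqueness of the flow, the inclusion of [D0] in the domain D
    with equality of [Psi] and [Phi] there ([flow_sub_maximal]), and the flow
    property of [Phi], because a shifted maximal integral curve is the maximal
    one through the shifted point ([maximal_curve_shift], [maximal_curveD]).

    Openness of D and smoothness of [Phi] hold near [(0, x)], where [Phi] is the
    given local flow.  They spread along the maximal curve through x: for times
    s and t close to each other, and q near [(t, x)], [Phi q] is obtained by
    following [Phi] up to time s and then [Psi] for a short time
    ([smooth_point_step]), a composition of smooth maps ([flow_step_smooth]).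

    The calculus behind this is that of Michal and Bastiani.  Its analytic core
    is a mean value theorem ([mean_value_convex]): if the derivative of a curve
    stays in a convex open set, so do its difference quotients.  Local convexity
    of E enters only there, by way of small convex neighbourhoods.  From it
    follow uniform convergence of difference quotients ([cvg_diff_quotient]),
    the chain rule, and stability of C^n maps under composition ([Cn_comp]).
    Propagation along an interval, used for the mean value theorem, for the
    uniqueness of integral curves and for smoothness alike, is
    [interval_induction]. *)

Set Implicit Arguments.
Unset Strict Implicit.

(** * Neighbourhoods and limits *)

Lemma open_near (T : topologicalType) (U : set T) (x : T) :
  open U -> U x -> \forall y \near x, U y.
Proof. by move=> Uo Ux; apply: open_nbhs_nbhs. Qed.

Lemma open_setX (T T' : topologicalType) (A : set T) (B : set T') :
  open A -> open B -> open (A `*` B).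
Proof.
move=> Ao Bo; rewrite openE => -[x y] [/= Ax By].
by exists (A, B) => //; split => /=; exact: open_nbhs_nbhs.
Qed.

Lemma continuous_near_eq (T T' : topologicalType) (f g : T -> T') (x : T) :
  (\forall y \near x, f y = g y) -> {for x, continuous g} ->
  {for x, continuous f}.
Proof.
move=> fg; rewrite /prop_for /continuous_at (nbhs_singleton fg).
apply: cvg_trans; apply: near_eq_cvg.
by apply: filterS fg => y ->.
Qed.

Lemma open_preimage_on (T T' : topologicalType) (U : set T) (V : set T')
    (f : T -> T') : open U -> open V ->
  (forall x, U x -> {for x, continuous f}) -> open (U `&` f @^-1` V).
Proof.
move=> Uo Vo fc; rewrite openE => x [Ux Vfx].
apply: filterI; first exact: open_near.
by apply: (fc x Ux V); exact: open_near.
Qed.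

Lemma addl_continuous (R : realType) (a : R) : continuous (fun s : R => a + s).
Proof. by move=> s; apply: cvgD; [exact: cvg_cst|exact: cvg_id]. Qed.

Lemma time_curve_continuous (R : realType) (T : topologicalType)
    (f : R -> R) (g : R -> T) (t : R) :
  {for t, continuous f} -> {for t, continuous g} ->
  {for t, continuous (fun s => (f s : R^o, g s))}.
Proof.
move=> fc gc.
exact: (@cvg_pair _ _ _ (nbhs t) (nbhs (f t)) (nbhs (g t)) _ _ _ f g fc gc).
Qed.

Section tvs_limits.
Context (R : realType) (E : tvsType R) (T : Type) (G : set_system T).
Context {FG : Filter G}.

Lemma tvs_cvgD (f g : T -> E) (a b : E) :
  f @ G --> a -> g @ G --> b -> (fun x => f x + g x) @ G --> a + b.
Proof.
move=> fa gb.
exact: (@continuous2_cvg T E E E G FG f g +%R a b (add_continuous (a, b))).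
Qed.

Lemma tvs_cvgZ (r : T -> R) (f : T -> E) (k : R) (a : E) :
  r @ G --> k -> f @ G --> a -> (fun x => r x *: f x) @ G --> k *: a.
Proof.
move=> rk fa.
exact: (@continuous2_cvg T R^o E E G FG r f *:%R k a
  (scale_continuous (k : R^o, a))).
Qed.

End tvs_limits.

(** * The mean value theorem in locally convex spaces *)

(** Cousin's principle: the supremum of the [t] with [P a t] has a
    neighbourhood on which [P] holds, so it is attained and cannot be less
    than [b].  The local hypothesis only compares points on the two sides of
    [s], which is what a derivative at [s] controls. *)
Lemma interval_induction (R : realType) (P : R -> R -> Prop) (a b : R) :
  a <= b ->
  (forall x y z, P x y -> P y z -> P x z) ->
  (forall s, a <= s <= b -> exists2 U, nbhs s U &
    forall x y, U x -> U y -> a <= x -> x <= s -> s <= y -> y <= b -> P x y) ->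
  P a b.
Proof.
move=> ab Ptrans Ploc.
pose S := [set t | a <= t <= b /\ P a t].
have Sa : S a.
  split; first by rewrite lexx.
  have [|U /nbhs_singleton Ua PU] := Ploc a; first by rewrite lexx.
  exact: PU.
have Sub : ubound S b by move=> t [/andP[]].
have supS : has_sup S by split; [exists a|exists b].
set s := sup S.
have as_ : a <= s by exact: (ub_le_sup (ex_intro _ b Sub)).
have sb : s <= b by apply: ge_sup; first by exists a.
have [|U /nbhs_ballP[d /= d0 dU] PU] := Ploc s; first by rewrite as_.
have [t [/andP[at_ tb] Pat] dt] := sup_adherent d0 supS.
have ts : t <= s.
  by apply: (ub_le_sup (ex_intro _ b Sub)); split => //; rewrite at_.
have Ut : U t.
  by apply: dU; rewrite /ball /= ger0_norm; rewrite -/s in dt *; lra.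
pose r := Num.min b (s + d / 2).
have sr : s <= r by rewrite /r le_min sb /=; lra.
have Pr : P a r.
  apply: Ptrans Pat _; apply: PU => //; last by rewrite /r ge_min lexx.
  apply: dU; rewrite /ball /= ler0_norm; last by lra.
  by have : r <= s + d / 2 by [rewrite /r ge_min lexx orbT]; lra.
have rs : r <= s.
  apply: (ub_le_sup (ex_intro _ b Sub)); split => //.
  by rewrite (le_trans as_ sr) /= /r ge_min lexx.
have rb : r = b.
  move: rs; rewrite /r; case: (leP b (s + d / 2)) => // _ ?; lra.
by rewrite -rb.
Qed.

Lemma has_derivP (R : realType) (E F : tvsType R) (f : E -> F) (x v : E)
    (l : F) :
  has_deriv f x v l <-> forall V, nbhs l V ->
    \forall h \near (0 : R), h != 0 -> V (h^-1 *: (f (x + h *: v) - f x)).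
Proof. by []. Qed.

Section mean_value.
Context (R : realType) (E : tvsType R).

Lemma open_convex_nbhs (x : E) (V : set E) : nbhs x V ->
  exists N : set E, [/\ open N, convex_set N, N x & N `<=` V].
Proof.
move=> xV; have [B Bconv [Bopen Bbasis]] := @locally_convex R E.
have [N [BN Nx] NV] := Bbasis x V xV.
by exists N; split=> //; [exact: Bopen|apply: Bconv; rewrite inE].
Qed.

(** The sets [a *: N], for N convex, add up like their coefficients; this is
    what makes the increment property of the mean value theorem transitive. *)
Lemma convex_set_wsum (N : set E) (a b : R) (x y : E) :
  convex_set N -> 0 <= a -> 0 <= b -> N x -> N y ->
  exists2 z, N z & a *: x + b *: y = (a + b) *: z.
Proof.
move=> Nconv a0 b0 Nx Ny.
have [ab0|ab_neq0] := eqVneq (a + b) 0.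
  have [-> ->] : a = 0 /\ b = 0 by split; lra.
  by exists x; rewrite ?addr0 ?scale0r ?addr0.
have ab_gt0 : 0 < a + b by rewrite lt_neqAle eq_sym ab_neq0 addr_ge0.
have l0 : 0 <= a / (a + b) by rewrite divr_ge0 // ltW.
have l1 : a / (a + b) <= 1 by rewrite ler_pdivrMr // mul1r lerDl.
pose l : {i01 R} := Itv01 l0 l1.
have := Nconv x y l; rewrite !inE => /(_ Nx Ny) Nz.
exists ((a / (a + b)) *: x + (1 - a / (a + b)) *: y); first exact: Nz.
rewrite scalerDr !scalerA mulrBr mulr1 mulrCA divff // mulr1.
by rewrite [a + b]addrC addrK.
Qed.

(** Since N is a neighbourhood of the derivative at [s], difference quotients
    between [s] and nearby points lie in N; by convexity so do those between
    two points on opposite sides of [s], and interval induction applies. *)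
Lemma mean_value_convex (N : set E) (g : R -> E) (g' : R -> E) (a b : R) :
  a <= b -> open N -> convex_set N ->
  (forall s, a <= s <= b -> @has_deriv R R^o E g s 1 (g' s)) ->
  (forall s, a <= s <= b -> N (g' s)) ->
  exists2 z, N z & g b - g a = (b - a) *: z.
Proof.
move=> ab Nopen Nconv gg' Ng'.
pose P x y := x <= y /\ exists2 z, N z & g y - g x = (y - x) *: z.
suff [] : P a b by [].
apply: interval_induction => // [x y z [xy [p Np pE]] [yz [q Nq qE]]|s sab].
  split; first exact: le_trans yz.
  have [] := convex_set_wsum (a := y - x) (b := z - y) Nconv _ _ Np Nq; try lra.
  move=> r Nr rE; exists r => //.
  have <- : (y - x) + (z - y) = z - x by ring.
  by rewrite -rE -pE -qE [RHS]addrC addrA subrK.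
have nN : \forall h \near (0 : R), h != 0 -> N (h^-1 *: (g (s + h) - g s)).
  have [+ _] := has_derivP (g : R^o -> E) s (1 : R^o) (g' s).
  move=> /(_ (gg' s sab) N (open_nbhs_nbhs (conj Nopen (Ng' s sab)))).
  by apply: filterS => h; rewrite [h *: 1]mulr1.
pose U := [set y | y - s != 0 -> N ((y - s)^-1 *: (g (s + (y - s)) - g s))].
have sU : nbhs s U.
  have : (fun y : R => y - s) @ s --> (0 : R).
    by rewrite -[0 : R](subrr s); apply: cvgB; [exact: cvg_id|exact: cvg_cst].
  by move=> /(_ _ nN).
exists U => // x y Ux Uy _ xs sy _.
have incr z : U z -> exists2 w, N w & g z - g s = (z - s) *: w.
  move=> Uz; have [zs|zs] := eqVneq (z - s) 0.
    exists (g' s); first exact: Ng'.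
    by move/eqP: zs; rewrite subr_eq0 => /eqP ->; rewrite !subrr scale0r.
  exists ((z - s)^-1 *: (g (s + (z - s)) - g s)); first exact: Uz.
  by rewrite scalerA divff // scale1r [s + _]addrC subrK.
have [p Np pE] := incr x Ux; have [q Nq qE] := incr y Uy.
split; first exact: le_trans sy.
have [] := convex_set_wsum (a := s - x) (b := y - s) Nconv _ _ Np Nq; try lra.
move=> r Nr rE; exists r => //.
have <- : (s - x) + (y - s) = y - x by ring.
by rewrite -rE -[s - x]opprB scaleNr -pE -qE opprB [RHS]addrC addrA subrK.
Qed.

(** The difference quotient between the end points lies in every convex
    neighbourhood of 0. *)
Lemma zero_deriv_constant (g : R -> E) (a b : R) :
  hausdorff_space E -> a <= b ->
  (forall s, a <= s <= b -> @has_deriv R R^o E g s 1 0) -> g b = g a.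
Proof.
move=> hE ab g0; have [->//|ab_neq] := eqVneq a b.
have ba0 : b - a != 0 by rewrite subr_eq0 eq_sym.
suff z0 : 0 = (b - a)^-1 *: (g b - g a).
  apply/eqP; rewrite -subr_eq0.
  by rewrite -[g b - g a](scale1r) -(divff ba0) -scalerA -z0 scaler0.
apply: hE => A B A0 Bz; exists ((b - a)^-1 *: (g b - g a)); split; last first.
  exact: nbhs_singleton.
have [N [Nopen Nconv N0 NA]] := open_convex_nbhs A0.
have [|z Nz ->] := mean_value_convex ab Nopen Nconv g0; first by [].
by rewrite scalerA mulVf // scale1r; exact: NA.
Qed.

End mean_value.

(** * Directional derivatives *)

Section derivatives.
Context (R : realType).
Implicit Types E F G : tvsType R.

Lemma has_deriv_line E F (f : E -> F) (x v : E) (s : R) (l : F) :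
  has_deriv f (x + s *: v) v l ->
  @has_deriv R R^o F (fun t => f (x + t *: v)) s 1 l.
Proof.
rewrite /has_deriv; apply: cvg_trans; apply: near_eq_cvg; near=> h.
by rewrite [h *: 1]mulr1 scalerDl addrA.
Unshelve. all: by end_near. Qed.

(** A C^1 map in the sense of Michal and Bastiani is differentiable in a
    locally uniform way: base point and direction may vary with [h].  The
    quotient is a mean value of the derivatives [df (Y h + s *: W h, W h)] with
    [s] between 0 and [h], and these are uniformly close to [df (x, v)].  The
    chain rule and all the velocity computations come from this lemma. *)
Lemma cvg_diff_quotient E F (U : set E) (f : E -> F) (df : E * E -> F)
    (x v : E) (Y W : R -> E) :
  open U -> U x -> (forall y w, U y -> has_deriv f y w (df (y, w))) ->
  {for (x, v), continuous df} ->
  Y @ 0^' --> x -> W @ 0^' --> v ->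
  (fun h : R => h^-1 *: (f (Y h + h *: W h) - f (Y h))) @ 0^' --> df (x, v).
Proof.
move=> Uopen Ux fdf dfc Yx Wv V Vl.
have [N [Nopen Nconv Nl NV]] := open_convex_nbhs Vl.
(* joint continuity at s = 0 confines the whole segment from Y h to
   Y h + h *: W h, so that the mean value theorem applies along it *)
pose phi (p : R^o * (E * E)) := (p.2.1 + p.1 *: p.2.2, p.2.2).
pose z : R^o * (E * E) := (0, (x, v)).
have phic : phi @ z --> (x, v).
  have c2 : (fun p : R^o * (E * E) => p.2.2) @ z --> v.
    apply: (@cvg_comp _ _ _ _ _ _ (nbhs (x, v))); first exact: cvg_snd.
    exact: cvg_snd.
  apply: (@cvg_pair _ _ _ (nbhs z) (nbhs x) (nbhs v)) => //=.
  have -> : nbhs x = nbhs (x + 0 *: v) by rewrite scale0r addr0.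
  apply: tvs_cvgD.
    apply: (@cvg_comp _ _ _ _ _ _ (nbhs (x, v))); first exact: cvg_snd.
    exact: cvg_fst.
  by apply: tvs_cvgZ => //; exact: cvg_fst.
have : nbhs z [set p | U (phi p).1 /\ N (df (phi p))].
  apply: filterI; last first.
    by apply: (phic (df @^-1` N)); apply: dfc; exact: open_nbhs_nbhs.
  apply: (phic (fst @^-1` U)); apply: (@cvg_fst _ _ (nbhs x)).
  exact: open_nbhs_nbhs.
move=> [[A B] /= [A0 Bxv] AB].
have [d /= d0 dA] := A0.
have YWB : \forall h \near (0 : R)^', B (Y h, W h).
  have YWxv : (fun h => (Y h, W h)) @ (0 : R)^' --> (x, v) by exact: cvg_pair.
  exact: YWxv.
have hd : \forall h \near (0 : R)^', `|h| < d.
  apply: nbhs_dnbhs; exists d => //= h /=.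
  by rewrite sub0r normrN.
have hn0 : \forall h \near (0 : R)^', h != 0 by exact: nbhs_dnbhs_neq.
suff : \forall h \near (0 : R)^', N (h^-1 *: (f (Y h + h *: W h) - f (Y h))).
  by apply: filterS => h; exact: NV.
near=> h.
have hd' : `|h| < d by near: h.
have Bh : B (Y h, W h) by near: h.
have h0 : h != 0 by near: h.
pose g := (fun s : R => f (Y h + s *: W h)).
have line (s : R) : `|s| < d ->
    U (Y h + s *: W h) /\ N (df (Y h + s *: W h, W h)).
  by move=> sd; apply: (AB (s, (Y h, W h))); split => //=; apply: dA => /=;
    rewrite sub0r normrN.
have MV (a b : R) : a <= b -> `|a| < d -> `|b| < d ->
    exists2 n, N n & g b - g a = (b - a) *: n.
  move=> ab ad bd.
  have sd s : a <= s <= b -> `|s| < d.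
    by move: ad bd; rewrite !ltr_norml => /andP[? ?] /andP[? ?] /andP[? ?]; lra.
  apply: (mean_value_convex (g' := fun s => df (Y h + s *: W h, W h))) => //.
    move=> s /sd/line[Us _]; apply: has_deriv_line; exact: fdf.
  by move=> s /sd/line[].
have d00 : `|0 : R| < d by rewrite normr0.
have g0 : f (Y h) = g 0 by rewrite /g scale0r addr0.
have -> : f (Y h + h *: W h) - f (Y h) = g h - g 0 by rewrite g0.
suff [n Nn ->] : exists2 n, N n & g h - g 0 = h *: n.
  by rewrite scalerA mulVf // scale1r.
have [h_le0|/ltW h_ge0] := leP h 0.
  have [n Nn nE] := MV _ _ h_le0 hd' d00; exists n => //.
  by rewrite -opprB nE sub0r scaleNr opprK.
have [n Nn nE] := MV _ _ h_ge0 d00 hd'; exists n => //.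
by rewrite nE subr0.
Unshelve. all: by end_near. Qed.

Lemma has_deriv_comp E F G (U : set F) (f : E -> F) (g : F -> G)
    (dg : F * F -> G) (x v : E) (l : F) :
  open U -> U (f x) -> (forall y w, U y -> has_deriv g y w (dg (y, w))) ->
  {for (f x, l), continuous dg} ->
  has_deriv f x v l -> has_deriv (g \o f) x v (dg (f x, l)).
Proof.
move=> Uopen Ufx gdg dgc fl.
pose W (h : R) := h^-1 *: (f (x + h *: v) - f x).
have : (fun h : R => h^-1 *: (g (f x + h *: W h) - g (f x))) @ 0^' -->
    dg (f x, l).
  by apply: (cvg_diff_quotient Uopen Ufx gdg dgc) => //; exact: cvg_cst.
apply: cvg_trans; apply: near_eq_cvg; near=> h.
have h0 : h != 0 by near: h; exact: nbhs_dnbhs_neq.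
by rewrite /= scalerA divff // scale1r [f x + _]addrC subrK.
Unshelve. all: by end_near. Qed.

Lemma has_deriv_near E F (f g : E -> F) (x v : E) (l : F) :
  (\forall y \near x, f y = g y) -> has_deriv g x v l -> has_deriv f x v l.
Proof.
move=> fg; apply: cvg_trans; apply: near_eq_cvg.
have lx : (fun h : R => x + h *: v) @ 0^' --> x.
  have -> : nbhs x = nbhs (x + 0 *: v) by rewrite scale0r addr0.
  apply: tvs_cvgD; first exact: cvg_cst.
  by apply: tvs_cvgZ; [exact: cvg_within|exact: cvg_cst].
have fg0 := nbhs_singleton fg.
have lfg : \forall h \near (0 : R)^', f (x + h *: v) = g (x + h *: v).
  exact: (lx [set y | f y = g y] fg).
near=> h; rewrite fg0; congr (_ *: (_ - _)).
by symmetry; near: h.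
Unshelve. all: by end_near. Qed.

Lemma has_deriv_unique E F (f : E -> F) (x v : E) (l m : F) :
  hausdorff_space F -> has_deriv f x v l -> has_deriv f x v m -> l = m.
Proof. by move=> hF; exact: (cvg_unique hF). Qed.

Lemma has_deriv_pair E F G (f : E -> F) (g : E -> G) (x v : E) (l : F) (m : G) :
  has_deriv f x v l -> has_deriv g x v m ->
  has_deriv (fun y => (f y, g y)) x v (l, m).
Proof.
move=> fl gm.
exact: (@cvg_pair _ _ _ _ (nbhs l) (nbhs m) _ _ _ _ _ fl gm).
Qed.

Lemma has_derivN E F (f : E -> F) (x v : E) (l : F) :
  has_deriv f x v l -> has_deriv f x (- v) (- l).
Proof.
move=> fl.
have opp0 : (-%R : R -> R) @ (0 : R)^' --> (0 : R)^'.
  rewrite -[X in _ --> X^']oppr0; apply: continuous_injective_withinNx.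
    exact: opp_continuous.
  by move=> y /oppr_inj.
have : (fun h : R => - ((- h)^-1 *: (f (x + (- h) *: v) - f x))) @ 0^' --> - l.
  apply: (cvg_comp _ (-%R : F -> F) (G := nbhs l)); last exact: opp_continuous.
  exact: (cvg_comp _ _ opp0 fl).
apply: cvg_trans; apply: near_eq_cvg; near=> h.
by rewrite invrN scaleNr opprK scaleNr scalerN.
Unshelve. all: by end_near. Qed.

Lemma has_deriv0 E F (f : E -> F) (x : E) : has_deriv f x 0 0.
Proof.
have : cst (0 : F) @ (0 : R)^' --> (0 : F) by exact: cvg_cst.
apply: cvg_trans; apply: near_eq_cvg; near=> h.
by rewrite scaler0 addr0 subrr scaler0.
Unshelve. all: by end_near. Qed.

End derivatives.

(** * Maps of class C^n *)

Section Cn_theory.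
Context (R : realType).
Implicit Types E F G : tvsType R.

Lemma CnS n E F (U : set E) (f : E -> F) : Cn n.+1 U f -> Cn n U f.
Proof.
elim: n E F U f => [|n IHn] E F U f [fc [df fdf dfn]]; split=> //.
by exists df => //; exact: IHn.
Qed.

Lemma Cn_continuous n E F (U : set E) (f : E -> F) :
  Cn n U f -> forall x, U x -> {for x, continuous f}.
Proof. by case: n => [|n] []. Qed.

Lemma Cn_sub n E F (U V : set E) (f : E -> F) :
  V `<=` U -> Cn n U f -> Cn n V f.
Proof.
elim: n E F U V f => [|n IHn] E F U V f VU.
  by move=> [fc _]; split=> // x /VU; exact: fc.
move=> [fc [df fdf dfn]]; split=> [x /VU|]; first exact: fc.
exists df => [x v /VU|]; first exact: fdf.
by apply: IHn dfn => -[x v] [/= /VU Ux].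
Qed.

Lemma Cn_eq n E F (U : set E) (f g : E -> F) :
  open U -> (forall x, U x -> f x = g x) -> Cn n U g -> Cn n U f.
Proof.
move=> Uo fg.
have fgn x : U x -> \forall y \near x, f y = g y.
  by move=> Ux; apply: filterS (open_near Uo Ux) => y; exact: fg.
have gfc : (forall x, U x -> {for x, continuous g}) ->
    forall x, U x -> {for x, continuous f}.
  by move=> gc x Ux; apply: continuous_near_eq (gc x Ux); exact: fgn.
case: n => [[/gfc]//|n [/gfc fc [dg gdg dgn]]]; split => //.
by exists dg => // x v Ux; apply: has_deriv_near (gdg x v Ux); exact: fgn.
Qed.

(** The derivative of an affine map is its linear part composed with the second
    projection, which is again linear: hence the induction. *)
Lemma Cn_affine n E F (U : set E) (f L : E -> F) :
  continuous f -> continuous L ->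
  (forall x v (h : R), f (x + h *: v) = f x + h *: L v) ->
  (forall x v (h : R), L (x + h *: v) = L x + h *: L v) ->
  Cn n U f.
Proof.
elim: n E F U f L => [|n IHn] E F U f L fc Lc fL LL.
  by split=> // x _; exact: fc.
split; first by move=> x _; exact: fc.
exists (L \o snd) => [x v _|].
  have : cst (L v) @ (0 : R)^' --> L v by exact: cvg_cst.
  apply: cvg_trans; apply: near_eq_cvg; near=> h.
  have h0 : h != 0 by near: h; exact: nbhs_dnbhs_neq.
  by rewrite fL [f x + _]addrC addrK scalerA mulVf // scale1r.
have Lsc : continuous (L \o snd : E * E -> F).
  by move=> p; apply: continuous_comp; [exact: cvg_snd|exact: Lc].
by apply: (IHn _ _ _ _ (L \o snd)) => // x v h; rewrite /= LL.
Unshelve. all: by end_near. Qed.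

Lemma Cn_pair n E F G (U : set E) (f : E -> F) (g : E -> G) :
  Cn n U f -> Cn n U g -> Cn n U (fun x => (f x, g x)).
Proof.
elim: n E F G U f g => [|n IHn] E F G U f g.
  move=> [fc _] [gc _]; split=> // x Ux.
  by apply: cvg_pair; [exact: fc|exact: gc].
move=> [fc [df fdf dfn]] [gc [dg gdg dgn]]; split=> [x Ux|].
  by apply: cvg_pair; [exact: fc|exact: gc].
exists (fun p => (df p, dg p)); last exact: IHn.
by move=> x v Ux; apply: has_deriv_pair; [exact: fdf|exact: gdg].
Qed.

(** The derivative of [g \o f] is [dg \o (f \o fst, df)], a composition of
    maps of class one less. *)
Lemma Cn_comp n E F G (U : set E) (V : set F) (f : E -> F) (g : F -> G) :
  open U -> open V -> (forall x, U x -> V (f x)) ->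
  Cn n U f -> Cn n V g -> Cn n U (g \o f).
Proof.
elim: n E F G U V f g => [|n IHn] E F G U V f g Uo Vo UV fn gn.
  split=> // x Ux; apply: continuous_comp; first exact: (Cn_continuous fn).
  by apply: (Cn_continuous gn); exact: UV.
split=> [x Ux|].
  apply: continuous_comp; first exact: (Cn_continuous fn).
  by apply: (Cn_continuous gn); exact: UV.
have [_ [df fdf dfn]] := fn; have [_ [dg gdg dgn]] := gn.
exists (dg \o (fun p => (f p.1, df p))) => [x v Ux|].
  apply: (has_deriv_comp Vo (UV x Ux) gdg); last exact: fdf.
  by apply: (Cn_continuous dgn); split=> //; exact: UV.
apply: (IHn _ _ _ _ (V `*` setT)) => //.
- by apply: open_setX => //; exact: openT.
- by apply: open_setX => //; exact: openT.
- by move=> [x v] [/= Ux _]; split=> //; exact: UV.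
- apply: Cn_pair => //.
  apply: (IHn _ _ _ _ U fst f) => //.
  + by apply: open_setX => //; exact: openT.
  + by move=> [x v] [].
  + by apply: (@Cn_affine _ _ _ _ fst fst) => //= x; exact: cvg_fst.
  + exact: CnS.
Qed.

(** Local derivatives agree where they overlap, because limits in F are unique;
    they can therefore be glued into a global one. *)
Lemma Cn_local n E F (U : set E) (f : E -> F) : hausdorff_space F ->
  (forall x, U x -> exists V, [/\ open V, V x & Cn n V f]) -> Cn n U f.
Proof.
move=> hF; elim: n E U f => [|n IHn] E U f loc.
  by split=> // x /loc[V [_ Vx [fc _]]]; exact: fc.
split=> [x /loc[V [_ Vx [fc _]]]|]; first exact: fc.
pose df (p : E * E) := xget 0 [set l | has_deriv f p.1 p.2 l].
have dfP x v l : has_deriv f x v l -> df (x, v) = l.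
  move=> fl; apply: (has_deriv_unique hF _ fl).
  exact: (@xgetPex _ 0 [set l | has_deriv f x v l] (ex_intro _ l fl)).
exists df => [x v /loc[V [_ Vx [_ [dg fdg _]]]]|].
  by have fl := fdg x v Vx; rewrite (dfP _ _ _ fl).
apply: IHn => -[x v] [/= /loc[V [Vo Vx [_ [dg fdg dgn]]]] _].
exists (V `*` setT); split=> //; first by apply: open_setX => //; exact: openT.
apply: Cn_eq dgn; first by apply: open_setX => //; exact: openT.
by move=> [y w] [/= Vy _]; apply: dfP; exact: fdg.
Qed.

End Cn_theory.

(** * Smooth maps between manifolds *)

Section smooth_on_theory.
Context (R : realType) (N M : topologicalType) (E F : tvsType R).
Variables (A : set (chart N E)) (B : set (chart M F)).
Implicit Types (D V : set N) (f g : N -> M).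

Lemma open_chart_dom (c : chart N E) (d : chart M F) D f :
  open D -> (forall x, D x -> {for x, continuous f}) ->
  open (ccod c `&` cinv c @^-1` (D `&` f @^-1` cdom d)).
Proof.
move=> Do fc; apply: open_preimage_on; first exact: ccod_open.
  by apply: open_preimage_on => //; exact: cdom_open.
exact: cinv_continuous.
Qed.

Lemma smooth_on_local D f : hausdorff_space F ->
  (forall x, D x -> exists V, [/\ open V, V x & smooth_on A B V f]) ->
  smooth_on A B D f.
Proof.
move=> hF loc; split=> [x /loc[V [_ Vx [fc _]]]|c d Ac Bd n]; first exact: fc.
apply: (Cn_local hF) => u [cu [/= /loc[V [Vo Vx [fc fs]]] du]].
exists (ccod c `&` cinv c @^-1` (V `&` f @^-1` cdom d)); split=> //.
  exact: open_chart_dom.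
exact: fs.
Qed.

Lemma smooth_on_eq D f g : open D -> (forall x, D x -> f x = g x) ->
  smooth_on A B D g -> smooth_on A B D f.
Proof.
move=> Do fg [gc gs].
have fc x : D x -> {for x, continuous f}.
  move=> Dx; apply: continuous_near_eq (gc x Dx).
  by apply: filterS (open_near Do Dx); exact: fg.
split=> // c d Ac Bd n; apply: Cn_eq (Cn_sub _ (gs c d Ac Bd n)).
- exact: open_chart_dom.
- by move=> u [_ [/fg fgu _]] /=; rewrite fgu.
- by move=> u [cu [/[dup] Du /fg fgu]]; rewrite /= fgu.
Qed.

End smooth_on_theory.

(** If [Phi] is smooth near [(t1, x)], then moving along [Phi] up to the fixed
    time [t1] and then along [Psi] for the remaining time is smooth.  In charts
    this is a composition through a chart around the intermediate point. *)
Section flow_step.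
Context (R : realType) (E : tvsType R) (M : manifold E).
Variables (V1 D0 : set (R^o * M)) (Phi Psi : R^o * M -> M) (t1 : R).
Hypotheses (hE : hausdorff_space E) (V1o : open V1) (D0o : open D0).
Hypotheses (Phis : smooth_on (line_atlas M) (atlas M) V1 Phi)
  (Psis : smooth_on (line_atlas M) (atlas M) D0 Psi).

Let slice (p : R^o * M) : M := Phi (t1, p.2).
Let step (p : R^o * M) : R^o * M := (p.1 - t1, slice p).
Let V := [set p : R^o * M | V1 (t1, p.2)] `&` step @^-1` D0.

Let sub_t1_continuous : continuous (fun t : R^o => t - t1).
Proof. by move=> t; apply: tvs_cvgD; [exact: cvg_id|exact: cvg_cst]. Qed.

Let at_t1_continuous (T : topologicalType) :
  continuous (fun p : R^o * T => (t1 : R^o, p.2)).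
Proof.
move=> p; apply: (@cvg_pair _ _ _ (nbhs p) (nbhs t1) (nbhs p.2)).
  exact: cvg_cst.
exact: cvg_snd.
Qed.

Let slice_continuous p : V1 (t1, p.2) -> {for p, continuous slice}.
Proof.
move=> V1p; apply: (continuous_comp (at_t1_continuous (x := p))).
exact: Phis.1.
Qed.

Let step_continuous p : V1 (t1, p.2) -> {for p, continuous step}.
Proof.
move=> V1p.
apply: (@cvg_pair _ _ _ (nbhs p) (nbhs (p.1 - t1)) (nbhs (slice p))).
  apply: (@continuous_comp _ _ _ fst (fun t => t - t1)); first exact: cvg_fst.
  exact: sub_t1_continuous.
exact: slice_continuous.
Qed.

Let V1'_open : open [set p : R^o * M | V1 (t1, p.2)].
Proof.
by apply: (@open_comp _ _ _ V1) => // p _; exact: at_t1_continuous.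
Qed.

Lemma flow_step_open : open V.
Proof. exact: open_preimage_on. Qed.

Let stepped_continuous p : V p -> {for p, continuous (Psi \o step)}.
Proof.
move=> [V1p D0p]; apply: continuous_comp; first exact: step_continuous.
exact: Psis.1.
Qed.

Lemma flow_step_smooth : smooth_on (line_atlas M) (atlas M) V (Psi \o step).
Proof.
split=> // _ d [c Ac <-] Ad n; apply: (Cn_local hE) => -[s u].
set U := (X in X (s, u)) => Usu.
have Uo : open U by apply: open_chart_dom => //; exact: flow_step_open.
have [[_ cu] [[V1x D0x] dx]] := Usu.
have [e Ae ex] := atlas_cover (slice (s, cinv c u)).
pose O := U `&` (slice \o cinv (line_chart c)) @^-1` cdom e.
have Oo : open O.
  apply: open_preimage_on => //; first exact: cdom_open.
  move=> q [qc [[V1q _] _]]; apply: continuous_comp.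
    exact: cinv_continuous.
  exact: slice_continuous.
exists O; split => //.
pose G := d \o Psi \o cinv (line_chart e).
pose H := fun q : R^o * E =>
  (q.1 - t1 : R^o, (e \o Phi \o cinv (line_chart c)) (t1 : R^o, q.2)).
pose OF := ccod (line_chart c) `&`
  cinv (line_chart c) @^-1` (V1 `&` Phi @^-1` cdom e).
pose OG := ccod (line_chart e) `&`
  cinv (line_chart e) @^-1` (D0 `&` Psi @^-1` cdom d).
have OFo : open OF by apply: open_chart_dom => //; exact: Phis.1.
have OGo : open OG by apply: open_chart_dom => //; exact: Psis.1.
have cG : Cn n OG G by apply: Psis.2 => //; exists e.
have cF : Cn n OF (e \o Phi \o cinv (line_chart c)).
  by apply: Phis.2 => //; exists c.
apply: (@Cn_eq _ _ _ _ _ _ (G \o H)) => //.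
  by move=> [q1 q2] [_ eq]; rewrite /G /H /= cmapK.
apply: Cn_comp cG => //.
  move=> [q1 q2] [[[_ cq] [[V1q D0q] dq]] eq]; rewrite /H; split => /=.
    by split=> //; exact: cmap_cod.
  by rewrite cmapK.
apply: Cn_pair.
  apply: (@Cn_affine _ _ _ _ _ _ fst) => //=.
  - move=> q; apply: (@continuous_comp _ _ _ fst (fun t => t - t1)).
      exact: cvg_fst.
    exact: sub_t1_continuous.
  - by move=> q; exact: cvg_fst.
  - by move=> x v h; rewrite addrAC.
apply: (@Cn_comp _ _ _ _ _ _ OF (fun q : R^o * E => (t1 : R^o, q.2))) => //.
  by move=> [q1 q2] [[[_ cq] [[V1q D0q] dq]] eq].
apply: (@Cn_affine _ _ _ _ _ _ (fun q : R^o * E => (0 : R^o, q.2))) => //=.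
- exact: at_t1_continuous.
- move=> q; apply: (@cvg_pair _ _ _ (nbhs q) (nbhs 0) (nbhs q.2)).
    exact: cvg_cst.
  exact: cvg_snd.
- by move=> x v h; congr (_, _) => /=; rewrite scaler0 addr0.
- by move=> x v h; congr (_, _) => /=; rewrite scaler0 addr0.
Qed.

End flow_step.

(** * Curves that follow a flow *)

Section velocity.
Context (R : realType) (E : tvsType R) (M : manifold E).

Lemma has_velocity_shift (g : R -> M) (a t : R) x (v : tangent x) :
  has_velocity g (a + t) v -> has_velocity (fun s => g (a + s)) t v.
Proof.
move=> [gx gc gv]; split=> //.
  by apply: continuous_comp; [exact: addl_continuous|exact: gc].
move=> c Ac cx; have := gv c Ac cx.
apply: cvg_trans; apply: near_eq_cvg; near=> h.
by rewrite /= addrA.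
Unshelve. all: by end_near. Qed.

Lemma has_velocity_near (g k : R -> M) (t : R) x (v : tangent x) :
  (\forall s \near t, g s = k s) -> has_velocity k t v -> has_velocity g t v.
Proof.
move=> gk [kx kc kv]; split.
- by rewrite (nbhs_singleton gk).
- exact: continuous_near_eq kc.
- move=> c Ac cx; apply: has_deriv_near (kv c Ac cx).
  by apply: filterS gk => s /= ->.
Qed.

End velocity.

Section flow_curves.
Context (R : realType) (E : tvsType R) (M : manifold E) (X : vector_field M).
Variables (D : set (R^o * M)) (Psi : R^o * M -> M).
Hypotheses (hE : hausdorff_space E) (flow : local_flow D Psi)
  (vel : velocity_field Psi X).

Let Do : open D := flow_open flow.
Let Psic p : D p -> {for p, continuous Psi}.
Proof. exact: (flow_smooth flow).1. Qed.

(** The velocity at time [t] is the velocity at time 0 of the flow line that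
    starts at [Psi (t, x)], by the flow property. *)
Lemma flow_line_velocity (t : R) x :
  D (t, x) -> has_velocity (fun s => Psi (s, x)) t (X (Psi (t, x))).
Proof.
move=> Dtx.
apply: (@has_velocity_near _ _ _ _ (fun s => Psi (- t + s, Psi (t, x)))).
  have c1 : {for t, continuous (fun s : R => (s : R^o, x))}.
    by apply: time_curve_continuous; [exact: cvg_id|exact: cvg_cst].
  have c2 : {for t, continuous (fun s : R => (- t + s : R^o, Psi (t, x)))}.
    by apply: time_curve_continuous; [exact: addl_continuous|exact: cvg_cst].
  have n1 : \forall s \near t, D (s, x) by exact: (c1 D (open_near Do Dtx)).
  have D0 : D (- t + t, Psi (t, x)) by rewrite addNr; exact: (flow_dom0 flow).
  have n2 : \forall s \near t, D (- t + s, Psi (t, x)).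
    exact: (c2 D (open_near Do D0)).
  near=> s.
  have sE : t + (- t + s) = s by rewrite addrA subrr add0r.
  by rewrite (flowD flow) ?sE //; near: s.
apply: (@has_velocity_shift _ _ _ (fun s => Psi (s, Psi (t, x))) (- t) t).
by rewrite addNr; exact: vel.
Unshelve. all: by end_near. Qed.

(** Everything here happens in one chart [c], where the flow reads [F] and is
    C^1 on the open set [OF]. *)
Section chart_of_flow.
Variables (c : chart M E) (Ac : atlas M c).

Let F (q : R^o * E) : E := c (Psi (q.1, cinv c q.2)).
Let OF := ccod (line_chart c) `&`
  cinv (line_chart c) @^-1` (D `&` Psi @^-1` cdom c).

Let OFo : open OF.
Proof. exact: open_chart_dom. Qed.

Let OF_cmap (t : R) x :
  cdom c x -> D (t, x) -> cdom c (Psi (t, x)) -> OF (t, c x).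
Proof.
move=> cx Dtx cPx; split; first by split=> //=; exact: cmap_cod.
by rewrite /= cmapK.
Qed.

Let F_C1 : exists2 dF : (R^o * E) * (R^o * E) -> E,
  forall q w, OF q -> has_deriv F q w (dF (q, w)) &
  forall q w, OF q -> {for (q, w), continuous dF}.
Proof.
have : Cn 1 OF F by apply: (flow_smooth flow).2 => //; exists c.
move=> [_ [dF FdF [dFc _]]].
by exists dF => // q w OFq; apply: dFc.
Qed.

(** Flowing back for time [h] undoes the motion of the curve to first order.
    The quotient splits into the increment of [F] in time, taken at the moving
    base point [c (g (s + h))], and the increment of the curve; these tend to
    the coordinates of [- X (g s)] and of [X (g s)]. *)
Lemma untransported_velocity (g : R -> M) (s : R) :
  cdom c (g s) -> has_velocity g s (X (g s)) ->
  (fun h : R => h^-1 *: (c (Psi (- h, g (s + h))) - c (g s))) @ 0^' --> (0 : E).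
Proof.
move=> cgs [_ gc gv].
have [dF FdF dFc] := F_C1.
set v := tcoord (X (g s)) c.
have OF0 : OF (0, c (g s)).
  by apply: OF_cmap => //; [exact: flow_dom0 flow _|rewrite (flow0 flow)].
(* along the time axis F is a flow line read in the chart, whose derivative at
   time 0 is v; the sign comes from flowing backwards *)
have dFE : dF ((0 : R^o, c (g s)), (-1 : R^o, 0)) = - v.
  apply: (has_deriv_unique hE (FdF _ _ OF0)).
  have -> : (-1 : R^o, 0 : E) = - (1, 0) by congr (_, _); rewrite oppr0.
  apply: has_derivN; have [_ _ /(_ c Ac cgs)] := vel (g s).
  apply: cvg_trans; apply: near_eq_cvg; near=> h.
  by rewrite /F /= scaler0 addr0 cmapK.
have shift0 : {for 0, continuous (fun h : R => s + h)}.
  exact: addl_continuous.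
have gsc : {for 0, continuous (fun h : R => g (s + h))}.
  by apply: continuous_comp => //; rewrite addr0.
have cgsc : (fun h : R => c (g (s + h))) @ (0 : R)^' --> c (g s).
  have : {for 0, continuous (fun h : R => c (g (s + h)))}.
    apply: (@continuous_comp _ _ _ (fun h : R => g (s + h)) c) => //.
    by rewrite addr0; exact: cmap_continuous.
  rewrite /prop_for /continuous_at addr0 => cc.
  exact: cvg_within_filter.
pose q h := (0 : R^o, c (g (s + h))).
have l1 : (fun h : R => h^-1 *:
    (F (q h + h *: (-1 : R^o, 0 : E)) - F (q h))) @ 0^' --> - v.
  rewrite -dFE; apply: (cvg_diff_quotient OFo OF0 FdF) => //.
  - exact: dFc.
  - exact: (@cvg_pair _ _ _ _ (nbhs (0 : R^o)) (nbhs (c (g s))) _ _ _ (cst 0) _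
      (cvg_cst _)).
  - exact: cvg_cst.
have l2 : (fun h : R => h^-1 *: (c (g (s + h)) - c (g s))) @ 0^' --> v.
  apply: cvg_trans (gv c Ac cgs); apply: near_eq_cvg; near=> h.
  by rewrite /= [h *: _]mulr1.
have l12 : (fun h : R => h^-1 *: (F (q h + h *: (-1 : R^o, 0 : E)) - F (q h)) +
    h^-1 *: (c (g (s + h)) - c (g s))) @ 0^' --> - v + v.
  exact: tvs_cvgD.
rewrite addNr in l12.
apply: cvg_trans l12; apply: near_eq_cvg.
have ncg : \forall h \near (0 : R)^', cdom c (g (s + h)).
  apply: nbhs_dnbhs; apply: (gsc (cdom c)); rewrite addr0.
  exact: (open_near (cdom_open c) cgs).
near=> h.
have cgh : cdom c (g (s + h)) by near: h.
rewrite /F /= scaler0 addr0 add0r [h *: _]mulrN mulr1 !cmapK // (flow0 flow).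
by rewrite -scalerDr addrA subrK.
Unshelve. all: by end_near. Qed.

(** By the flow property, [Psi (- (s + h), g (s + h))] is the image under the
    time [- s] map of a point which, by [untransported_velocity], differs from
    [g s] by o(h) in the chart; so does its image from [Psi (- s, g s)]. *)
Lemma transported_velocity (g : R -> M) (s : R) :
  cdom c (g s) -> has_velocity g s (X (g s)) ->
  D (- s, g s) -> cdom c (Psi (- s, g s)) ->
  (\forall t \near s, D (- t, g t)) ->
  @has_deriv R R^o E (fun t => c (Psi (- t, g t))) s 1 0.
Proof.
move=> cgs gv Dgs cPgs nD.
have [dF FdF dFc] := F_C1.
have OFs : OF (- s, c (g s)) by exact: OF_cmap.
have dF0 : dF ((- s : R^o, c (g s)), (0 : R^o, 0)) = 0.
  exact: (has_deriv_unique hE (FdF _ _ OFs) (has_deriv0 _ _)).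
(* the base point of F stays fixed and only the direction (0, w h) varies; as
   w h tends to 0, the quotient tends to the derivative in direction 0 *)
pose w (h : R) := h^-1 *: (c (Psi (- h, g (s + h))) - c (g s)).
have w0 : w @ 0^' --> (0 : E) by exact: untransported_velocity.
have l : (fun h : R => h^-1 *: (F ((- s : R^o, c (g s)) + h *: (0 : R^o, w h))
     - F (- s : R^o, c (g s)))) @ 0^' -->
    dF ((- s : R^o, c (g s)), (0 : R^o, 0)).
  apply: (cvg_diff_quotient OFo OFs FdF) => //.
  - exact: dFc.
  - exact: cvg_cst.
  - exact: (@cvg_pair _ _ _ _ (nbhs (0 : R^o)) (nbhs (0 : E)) _ _ _ (cst 0) _
      (cvg_cst _)).
rewrite dF0 in l.
have shift0 : {for 0, continuous (fun h : R => s + h)}.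
  exact: addl_continuous.
have gsc : {for 0, continuous (fun h : R => g (s + h))}.
  by apply: continuous_comp => //; rewrite addr0; case: gv.
have pc : {for 0, continuous (fun h : R => (- h : R^o, g (s + h)))}.
  by apply: time_curve_continuous => //; exact: opp_continuous.
have D0 : D (- 0, g (s + 0)) by rewrite oppr0; exact: (flow_dom0 flow).
have Ppc : {for 0, continuous (fun h : R => Psi (- h, g (s + h)))}.
  by apply: (continuous_comp pc); exact: Psic.
have P0 : Psi (- 0, g (s + 0)) = g s by rewrite oppr0 addr0 (flow0 flow).
have PPc : {for 0, continuous (fun h : R => (- s : R^o, Psi (- h, g (s + h))))}.
  by apply: time_curve_continuous => //; exact: cvg_cst.
have n1 : \forall h \near (0 : R)^', D (- h, g (s + h)).
  by apply: nbhs_dnbhs; exact: (pc D (open_near Do D0)).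
have n2 : \forall h \near (0 : R)^', cdom c (Psi (- h, g (s + h))).
  apply: nbhs_dnbhs; apply: (Ppc (cdom c)); rewrite P0.
  exact: (open_near (cdom_open c) cgs).
have n3 : \forall h \near (0 : R)^', D (- s, Psi (- h, g (s + h))).
  apply: nbhs_dnbhs; apply: (PPc D); rewrite P0.
  exact: (open_near Do Dgs).
have n4 : \forall h \near (0 : R)^', D (- (s + h), g (s + h)).
  apply: nbhs_dnbhs; apply: (shift0 [set t | D (- t, g t)]).
  by rewrite addr0.
apply: cvg_trans l; apply: near_eq_cvg; near=> h.
have h0 : h != 0 by near: h; exact: nbhs_dnbhs_neq.
have cPh : cdom c (Psi (- h, g (s + h))) by near: h.
rewrite [h *: (1 : R^o)]mulr1 /F /= scaler0 addr0 !cmapK // /w.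
rewrite scalerA divff // scale1r [c (g s) + _]addrC subrK cmapK //.
rewrite (flowD flow) -?opprD 1?[h + s]addrC //; first by near: h.
- by near: h.
- by near: h.
Unshelve. all: by end_near. Qed.

End chart_of_flow.

End flow_curves.

Section flow_uniqueness.
Context (R : realType) (E : tvsType R) (M : manifold E) (X : vector_field M).
Variables (D : set (R^o * M)) (Psi : R^o * M -> M).
Hypotheses (hE : hausdorff_space E) (flow : local_flow D Psi)
  (vel : velocity_field Psi X).

Let Do : open D := flow_open flow.

(** The curve [Psi (- s, g s)] has zero velocity, hence is constant with value
    [g 0]; applying the time [s] map gives the claim. *)
Lemma flow_follows_at0 (g : R -> M) :
  (\forall s \near (0 : R), has_velocity g s (X (g s))) ->
  \forall s \near (0 : R), g s = Psi (s, g 0).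
Proof.
move=> gv; have [c Ac cg0] := atlas_cover (g 0).
have [_ g0c _] := nbhs_singleton gv.
have pc : {for 0, continuous (fun s : R => (- s : R^o, g s))}.
  by apply: time_curve_continuous => //; exact: opp_continuous.
have D0 : D (- 0, g 0) by rewrite oppr0; exact: (flow_dom0 flow).
have P0 : Psi (- 0, g 0) = g 0 by rewrite oppr0 (flow0 flow).
have Ppc : {for 0, continuous (fun s : R => Psi (- s, g s))}.
  by apply: (continuous_comp pc); exact: (flow_smooth flow).1.
have n1 : \forall s \near (0 : R), cdom c (g s).
  exact: (g0c _ (open_near (cdom_open c) cg0)).
have n2 : \forall s \near (0 : R), D (- s, g s).
  exact: (pc _ (open_near Do D0)).
have n3 : \forall s \near (0 : R), cdom c (Psi (- s, g s)).
  by apply: (Ppc (cdom c)); rewrite P0; exact: (open_near (cdom_open c)).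
have n4 : \forall s \near (0 : R), D (s, g 0).
  have sc : {for 0, continuous (fun s : R => (s : R^o, g 0))}.
    by apply: time_curve_continuous; [exact: cvg_id|exact: cvg_cst].
  exact: (sc _ (open_near Do (flow_dom0 flow (g 0)))).
have /nbhs_ballP[e /= e0 eQ] : \forall s \near (0 : R),
    [/\ has_velocity g s (X (g s)), cdom c (g s), D (- s, g s) &
        cdom c (Psi (- s, g s))].
  by near=> s; split; near: s.
have ball_e (s : R) : ball (0 : R) e s = (`|s| < e) :> Prop.
  by rewrite /ball /= sub0r normrN.
have Q s : `|s| < e -> [/\ has_velocity g s (X (g s)), cdom c (g s),
    D (- s, g s) & cdom c (Psi (- s, g s))].
  by move=> se; apply: eQ; rewrite ball_e.
have dk s : `|s| < e -> @has_deriv R R^o E (fun t => c (Psi (- t, g t))) s 1 0.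
  move=> se; have [gvs cgs Dgs cPs] := Q s se.
  apply: (transported_velocity hE flow vel) => //.
  have : \forall t \near s, ball (0 : R) e t.
    by apply: open_near; [exact: ball_open|rewrite ball_e].
  by apply: filterS => t; rewrite ball_e => /Q[].
have ne : \forall s \near (0 : R), `|s| < e.
  exact: nbhs0_lt.
near=> s.
have se : `|s| < e by near: s.
have Ds : D (s, g 0) by near: s.
have [_ cgs Dgs cPs] := Q s se.
have kE : c (Psi (- s, g s)) = c (g 0).
  have se' r : (0 <= r <= s) || (s <= r <= 0) -> `|r| < e.
    by move: se; rewrite !ltr_norml => /andP[? ?] /orP[]/andP[? ?]; lra.
  rewrite -P0; have [s0|/ltW s0] := leP 0 s.
    apply: (zero_deriv_constant (g := fun t => c (Psi (- t, g t))) hE s0).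
    by move=> r r0s; apply/dk/se'; rewrite r0s.
  symmetry.
  apply: (zero_deriv_constant (g := fun t => c (Psi (- t, g t))) hE s0).
  by move=> r r0s; apply/dk/se'; rewrite r0s orbT.
have kE' : Psi (- s, g s) = g 0 by rewrite -(cmapK cPs) kE cmapK.
rewrite -kE' (flowD flow) ?kE' ?addNr ?(flow0 flow) //.
exact: (flow_dom0 flow).
Unshelve. all: by end_near. Qed.

Lemma flow_follows (g : R -> M) (t : R) :
  (\forall s \near t, has_velocity g s (X (g s))) ->
  \forall s \near t, g s = Psi (s - t, g t).
Proof.
move=> gv.
have tc : {for 0, continuous (fun s : R => t + s)} by exact: addl_continuous.
have /flow_follows_at0 : \forall s \near (0 : R),
    has_velocity (fun s => g (t + s)) s (X (g (t + s))).
  have : \forall s \near (0 : R), has_velocity g (t + s) (X (g (t + s))).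
    by apply: (tc [set s | has_velocity g s (X (g s))]); rewrite addr0.
  by apply: filterS => s; exact: has_velocity_shift.
rewrite addr0 => gP.
have sc : {for t, continuous (fun s : R => - t + s)} by exact: addl_continuous.
have : \forall s \near t, g (t + (- t + s)) = Psi (- t + s, g t).
  by apply: (sc [set s | g (t + s) = Psi (s, g t)]); rewrite addNr.
by apply: filterS => s; rewrite addrA subrr add0r [- t + s]addrC.
Qed.

Lemma integral_curve_near (I : set R) (g : R -> M) (t : R) :
  integral_curve X I g -> I t -> \forall s \near t, has_velocity g s (X (g s)).
Proof. by move=> [Io _ _ gv] It; apply: filterS (open_near Io It). Qed.

(** Near a time where the curves meet, both follow the flow, so they agree; near
    a time where they differ, they keep differing, as M is Hausdorff.  So
    agreement at one time propagates along the interval, both ways. *)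
Lemma integral_curve_unique (I J : set R) (g k : R -> M) (t0 : R) :
  integral_curve X I g -> integral_curve X J k -> I t0 -> J t0 -> g t0 = k t0 ->
  forall t, I t -> J t -> g t = k t.
Proof.
move=> gI kJ It0 Jt0 gk0 t It Jt.
have [_ Iint _ gv] := gI; have [_ Jint _ kv] := kJ.
suff key a b : a <= b -> I a -> I b -> J a -> J b -> (g a = k a <-> g b = k b).
  have [t0t|/ltW tt0] := leP t0 t; first by apply/(key t0 t).
  by apply/(key t t0).
move=> ab Ia Ib Ja Jb.
pose P x y := g x = k x <-> g y = k y.
apply: (@interval_induction R P) => // [x y z xy yz|s sab].
  exact: (iff_trans xy yz).
have Is : I s by exact: Iint sab.
have Js : J s by exact: Jint sab.
have [gks|gks] := pselect (g s = k s).
  exists [set r | g r = k r]; last by move=> x y /= xE yE *; split.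
  have := flow_follows (integral_curve_near gI Is).
  have := flow_follows (integral_curve_near kJ Js).
  by apply: filterS2 => r /= -> ->; rewrite gks.
exists [set r | g r <> k r]; last by move=> x y /= xE yE *; split.
have [_ gc _] := gv s Is; have [_ kc _] := kv s Js.
have := @manifold_hausdorff _ _ M; rewrite open_hausdorff => /(_ (g s) (k s)).
case=> [|[A B] /= []]; first exact/eqP.
rewrite !inE => As Bs [Ao Bo AB0].
have nA : \forall r \near s, A (g r) by exact: (gc _ (open_near Ao As)).
have nB : \forall r \near s, B (k r) by exact: (kc _ (open_near Bo Bs)).
apply: filterS2 nA nB => r /= Ar Br gkr.
by have : (A `&` B) (g r); [split; rewrite // gkr|rewrite AB0].
Qed.

End flow_uniqueness.

(** * The flow of maximal integral curves *)

Section maximal_curves.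
Context (R : realType) (E : tvsType R) (M : manifold E) (X : vector_field M).
Variables (D0 : set (R^o * M)) (Psi : R^o * M -> M).
Hypotheses (hE : hausdorff_space E) (flow : local_flow D0 Psi)
  (vel : velocity_field Psi X).

Lemma integral_curve_shift (I : set R) (g : R -> M) (a : R) :
  integral_curve X I g -> I a ->
  integral_curve X [set t | I (a + t)] (fun t => g (a + t)).
Proof.
move=> [Io Iint I0 gv] Ia; split.
- by apply: open_comp Io => t _; exact: addl_continuous.
- move=> x y Iax Iay z /andP[xz zy]; apply: (Iint _ _ Iax Iay).
  by rewrite !lerD2l xz.
- by rewrite /= addr0.
- by move=> t It; apply: has_velocity_shift; exact: gv.
Qed.

Lemma integral_curve_glue (I J : set R) (g k : R -> M) :
  integral_curve X I g -> integral_curve X J k -> g 0 = k 0 ->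
  exists2 u, integral_curve X (I `|` J) u & forall t, I t -> u t = g t.
Proof.
move=> gI kJ gk0; have [Io Iint I0 gv] := gI; have [Jo Jint J0 kv] := kJ.
have gkE := integral_curve_unique hE flow vel gI kJ I0 J0 gk0.
pose u t := if `[< I t >] then g t else k t.
have ug t : I t -> u t = g t by rewrite /u => It; rewrite asboolT.
have uk t : J t -> u t = k t.
  by move=> Jt; rewrite /u; case: asboolP => // It; exact: gkE.
exists u => //; split.
- exact: openU.
- have zint (K : set R) : is_interval K -> K 0 ->
      forall x, K x -> forall z, (x <= z <= 0) || (0 <= z <= x) -> K z.
    by move=> Kint K0 x Kx z /orP[]; [exact: Kint|exact: Kint].
  move=> x y IJx IJy z /andP[xz zy]; have [z0|/ltW z0] := leP z 0.
    have zx : (x <= z <= 0) || (0 <= z <= x) by rewrite xz z0.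
    by case: IJx => Kx; [left|right]; exact: zint Kx _ zx.
  have zy' : (y <= z <= 0) || (0 <= z <= y) by rewrite zy z0 orbT.
  by case: IJy => Ky; [left|right]; exact: zint Ky _ zy'.
- by left.
- move=> t [It|Jt].
    rewrite ug //; apply: has_velocity_near (gv t It).
    by apply: filterS (open_near Io It).
  rewrite uk //; apply: has_velocity_near (kv t Jt).
  by apply: filterS (open_near Jo Jt).
Qed.

Lemma maximal_integral_curve_sub (I J : set R) (g k : R -> M) :
  maximal_integral_curve X I g -> integral_curve X J k -> g 0 = k 0 -> J `<=` I.
Proof.
move=> [gI gmax] kJ gk0.
have [u uIJ ug] := integral_curve_glue gI kJ gk0.
have <- := gmax _ _ uIJ (@subsetUl _ _ _) ug.
exact: subsetUr.
Qed.

Lemma flow_line_integral_curve x :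
  integral_curve X [set t : R | D0 (t, x)] (fun t => Psi (t, x)).
Proof.
split.
- apply: (@open_comp _ _ (fun t : R => (t : R^o, x)) D0).
    by move=> t _; apply: time_curve_continuous; [exact: cvg_id|exact: cvg_cst].
  exact: (flow_open flow).
- exact (flow_interval flow (x := x)).
- exact: (flow_dom0 flow).
- by move=> t Dtx; exact: (flow_line_velocity flow vel).
Qed.

Variables (I : M -> set R) (gamma : M -> R -> M).
Hypotheses (gamma_maximal : forall x, maximal_integral_curve X (I x) (gamma x))
  (gamma_0 : forall x, gamma x 0 = x).

Let gammaI x : integral_curve X (I x) (gamma x) := (gamma_maximal x).1.
Let I0 x : I x 0. Proof. by case: (gammaI x). Qed.

Lemma maximal_curve_unique x (J : set R) (k : R -> M) :
  integral_curve X J k -> k 0 = x ->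
  J `<=` I x /\ forall t, J t -> k t = gamma x t.
Proof.
move=> kJ k0.
have JI : J `<=` I x.
  by apply: (maximal_integral_curve_sub (gamma_maximal x) kJ); rewrite gamma_0.
split=> // t Jt; have [_ _ J0 _] := kJ.
apply: (integral_curve_unique hE flow vel kJ (gammaI x) J0 (I0 x)) => //.
  by rewrite gamma_0.
exact: JI.
Qed.

(** The inclusion of [I x - s] in [I (gamma x s)] holds by maximality.  Applied
    to the point [gamma x s] and the time [- s], which leads back to [x], it
    also gives the converse. *)
Lemma maximal_curve_shift x (s t : R) : I x s ->
  I x (s + t) <-> I (gamma x s) t.
Proof.
have sub y r : I y r -> [set u | I y (r + u)] `<=` I (gamma y r).
  move=> Iyr; have := integral_curve_shift (gammaI y) Iyr.
  by move=> /(@maximal_curve_unique (gamma y r)) []//; rewrite addr0.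
move=> Ixs; split; first exact: sub.
have Ins : I (gamma x s) (- s) by apply: (sub _ _ Ixs); rewrite /= subrr.
have gns : gamma (gamma x s) (- s) = x.
  have [] := maximal_curve_unique (integral_curve_shift (gammaI x) Ixs) erefl.
  rewrite addr0 => _ /(_ (- s)) /= <-; rewrite subrr //; exact: gamma_0.
move=> Igt; rewrite -gns; apply: (sub _ _ Ins).
by rewrite /= addrA addNr add0r.
Qed.

Lemma maximal_curveD x (s t : R) : I x s -> I x (s + t) ->
  gamma (gamma x s) t = gamma x (s + t).
Proof.
move=> Ixs Ixst.
have [] := maximal_curve_unique (integral_curve_shift (gammaI x) Ixs) erefl.
by rewrite addr0 => _ /(_ t Ixst) ->.
Qed.

Let D : set (R^o * M) := [set p | I p.2 p.1].
Let Phi (p : R^o * M) : M := gamma p.2 p.1.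

Lemma flow_sub_maximal p : D0 p -> D p /\ Psi p = Phi p.
Proof.
case: p => t x Dp.
have [sub eq] :=
  maximal_curve_unique (flow_line_integral_curve x) (flow0 flow x).
by split; [exact: sub|exact: eq].
Qed.

(** The neighbourhood is required to lie in D, so that openness of D and
    smoothness of [Phi] propagate together along integral curves. *)
Definition smooth_point (p : R^o * M) := exists V : set (R^o * M),
  [/\ open V, V p, V `<=` D & smooth_on (line_atlas M) (atlas M) V Phi].

Lemma smooth_point_flow p : D0 p -> smooth_point p.
Proof.
move=> Dp; exists D0; split => //; first exact: flow_open flow.
  by move=> q /flow_sub_maximal[].
apply: smooth_on_eq (flow_smooth flow); first exact: flow_open flow.
by move=> q /flow_sub_maximal[].
Qed.

(** For [q] near [(t, x)], [Phi q] is reached by following [Phi] up to time [s]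
    and then the given local flow for the time that remains. *)
Lemma smooth_point_step x (s t : R) : smooth_point (s, x) -> I x s ->
  D0 (t - s, gamma x s) -> smooth_point (t, x).
Proof.
move=> [V [Vo Vsx VD Vs]] Ixs Dts.
exists ([set p : R^o * M | V (s, p.2)] `&`
  (fun p : R^o * M => (p.1 - s : R^o, Phi (s, p.2))) @^-1` D0).
have D0o := flow_open flow.
have Wo := [elaborate flow_step_open (t1 := s) Vo D0o Vs].
have step q : V (s, q.2) -> D0 (q.1 - s, Phi (s, q.2)) ->
    D q /\ Phi q = Psi (q.1 - s, Phi (s, q.2)).
  case: q => r y /= /VD Iys /flow_sub_maximal[Igy ->].
  have rE : s + (r - s) = r by rewrite addrC subrK.
  have Iyr : I y r by rewrite -rE; apply/(maximal_curve_shift _ Iys).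
  by split => //; rewrite /Phi /= maximal_curveD // rE.
split=> //.
  by move=> q [Vq Dq]; have [] := step q Vq Dq.
apply: smooth_on_eq (flow_step_smooth s hE Vo D0o Vs (flow_smooth flow)).
  exact: Wo.
by move=> q [Vq Dq]; have [] := step q Vq Dq.
Qed.

(** Near a time [s], any two times of [I x] are so close that the local flow
    leads from the curve at the one to the curve at the other; hence
    smoothness at one implies smoothness at the other, and spreads from time 0
    over the whole interval. *)
Lemma smooth_point_maximal x (t : R) : I x t -> smooth_point (t, x).
Proof.
move=> Ixt; have [_ Iint _ gv] := gammaI x.
have S0 : smooth_point (0, x).
  by apply: smooth_point_flow; exact: (flow_dom0 flow).
pose P a b := smooth_point (a, x) <-> smooth_point (b, x).
suff key a b : a <= b -> I x a -> I x b -> P a b.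
  have [t0|/ltW t0] := leP 0 t; first by apply/(key 0 t).
  by apply/(key t 0).
move=> ab Ia Ib; apply: interval_induction => // [u v w uv vw|s sab].
  exact: (iff_trans uv vw).
have Is : I x s by exact: Iint sab.
have [_ gc _] := gv s Is.
have Io : open (I x) by case: (gammaI x).
have dc : {for (s, s), continuous
    (fun p : R * R => (p.2 - p.1 : R^o, gamma x p.1))}.
  apply: (@cvg_pair _ _ _ (nbhs (s, s)) (nbhs (s - s)) (nbhs (gamma x s))).
    by apply: cvgB; [exact: cvg_snd|exact: cvg_fst].
  by apply: continuous_comp; [exact: cvg_fst|exact: gc].
have D00 : D0 (s - s, gamma x s) by rewrite subrr; exact: (flow_dom0 flow).
have [[A B] /= [As Bs] AB] := dc _ (open_near (flow_open flow) D00).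
exists (A `&` B `&` I x).
  by apply: filterI; [exact: filterI|exact: (open_near Io Is)].
move=> u v [[Au Bu] Iu] [[Av Bv] Iv] _ _ _ _; split => Su.
  by apply: (smooth_point_step Su Iu); exact: (AB (u, v)).
by apply: (smooth_point_step Su Iv); exact: (AB (v, u)).
Qed.

Lemma maximal_flow_open : open D.
Proof.
rewrite openE => -[t x] /smooth_point_maximal[V [Vo Vtx VD _]].
exact: filterS VD (open_near Vo Vtx).
Qed.

Lemma maximal_local_flow : local_flow D Phi.
Proof.
split.
- exact: maximal_flow_open.
- exact: I0.
- by move=> x; case: (gammaI x).
- apply: (smooth_on_local hE) => -[t x] /smooth_point_maximal[V [? ? _ ?]].
  by exists V.
- exact: gamma_0.
- by move=> t s x Dsx _ Dst; exact: maximal_curveD.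
Qed.

End maximal_curves.

Unset Implicit Arguments.
Theorem theorem2p6 (R : realType) (E : tvsType R) (E_hausdorff : hausdorff_space E)
  (M : manifold E) (X : vector_field M) (X_integrable : locally_integrable_field X)
  (I : M -> set R) (gamma : M -> R -> M)
  (gamma_maximal : forall x, maximal_integral_curve X (I x) (gamma x))
  (gamma_0 : forall x, gamma x 0 = x) :
  let D : set (R^o * M) := \bigcup_x (I x `*` [set x]) in
  let Phi : R^o * M -> M := fun p => gamma p.2 p.1 in
  [/\ local_flow D Phi, velocity_field Phi X &
      forall Psi : R^o * M -> M, local_flow D Psi -> velocity_field Psi X ->
        forall p, D p -> Psi p = Phi p].
Proof.
have [D0 [Psi0 [flow0 vel0]]] := X_integrable; move=> D Phi.
have -> : D = [set p | I p.2 p.1].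
  apply/seteqP; split=> [[t x] [y _ [/= It ->]]//|[t x] /= It].
  by exists x.
split.
- exact: (maximal_local_flow E_hausdorff flow0 vel0).
- move=> x; have [[_ _ I0 gv] _] := gamma_maximal x.
  by have := gv 0 I0; rewrite gamma_0.
- move=> Psi flow vel p Dp.
  by have [] := flow_sub_maximal E_hausdorff flow vel gamma_maximal gamma_0 Dp.
Qed.
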